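(* Let $x$ be a nondegenerate space curve in $\mathbf{A}^3$ without affine inflection points, with first and second general-affine curvatures $k$ and $M$ and sign $\epsilon=\pm1$. Then, relative to a general-affine length parameter (with $'$ the derivative with respect to it), $x$ satisfies the ordinary differential equation \[ x''''+3kx'''+\Bigl(2k'+\tfrac{11}{4}k^2+\epsilon\Bigr)x''+\Bigl(M+\tfrac12\epsilon k+\tfrac12k''+\tfrac74kk'+\tfrac34k^3\Bigr)x'=0 . \]
   Context: All curves are smooth. A parametrized curve $x=x(t)$ in $\mathbf{A}^3$ is nondegenerate if $x',x'',x'''$ are linearly independent at every point. For a nondegenerate curve there exist a frame $e_1,e_2,e_3$ along $x$ (smooth, pointwise linearly independent vector fields along $x$, with $e_1$ a positive multiple of $dx/dt$), a $1$-form $\omega$ and functions $\ell,m$ such that $dx=\omega e_1$, $de_1=\omega e_2$, $de_2=\omega e_3$, $de_3=-m\omega e_1-\ell\omega e_2$. These are unique up to $\tilde e_i=\lambda^ie_i$ ($i=1,2,3$), $\tilde\omega=\lambda^{-1}\omega$, $\tilde\ell=\lambda^2\ell$, $\tilde m=\lambda^3m$ with a constant $\lambda>0$. A point where $\ell=0$ is an affine inflection point. Where $\ell\neq0$, the sign is $\epsilon=\mathrm{sign}(\ell)$. The general-affine length element is $\omega_s=\sqrt{\epsilon\ell}\,\omega$; a general-affine length parameter is a parameter $s$ with $ds=\omega_s$. The first general-affine curvature $k$ is defined by $d\ell/\ell=k\,\omega_s$, and the second general-affine curvature is $M=m/(\epsilon\ell)^{3/2}$. *)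

(* Defs.v *)
From HB Require Import structures.
From mathcomp Require Import all_boot all_order all_algebra.
From mathcomp Require Import all_classical all_reals all_analysis.

Set Implicit Arguments.
Unset Strict Implicit.
Unset Printing Implicit Defensive.

Import Order.TTheory GRing.Theory Num.Theory.
Import numFieldNormedType.Exports.

Local Open Scope ring_scope.
Local Open Scope classical_set_scope.

(* Affine 3-space and its vectors are both 'rV[R]_3, through a choice of affine
   coordinates.  Curves, and functions or vector fields along a curve, are
   total functions of a parameter t, used only on an open interval I. *)

(* The n-th derivative of f exists on I for every n.  Since [derivable] at t
   depends only on the germ of the function at t, this is the usual notion as
   soon as I is open. *)
Definition smooth_on (R : realType) (V : normedModType R) (I : set R)
    (f : R -> V) : Prop :=
  forall (n : nat) (t : R), I t -> derivable (derive1n n f) t 1.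

Definition nondegenerate_curve (R : realType) (I : set R)
    (x : R -> 'rV[R]_3) : Prop :=
  forall t : R, I t -> free [:: derive1 x t; derive1n 2 x t; derive1n 3 x t].

(* A 1-form omega on I is given by its coefficient w: omega = w dt.  The
   structure equations, e.g. de2 = omega e3, are equations between
   vector-valued 1-forms, stated here on the coefficients of dt.  As for any
   form or function along a smooth curve, omega, l and m are taken to be smooth;
   the other fields also force this. *)
Record affine_frame (R : realType) (I : set R) (x : R -> 'rV[R]_3)
    (e1 e2 e3 : R -> 'rV[R]_3) (w l m : R -> R) : Prop := AffineFrame {
  frame_smooth1 : smooth_on I e1 ;
  frame_smooth2 : smooth_on I e2 ;
  frame_smooth3 : smooth_on I e3 ;
  frame_smoothw : smooth_on I w ;
  frame_smoothl : smooth_on I l ;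
  frame_smoothm : smooth_on I m ;
  frame_free : forall t : R, I t -> free [:: e1 t; e2 t; e3 t] ;
  frame_positive : forall t : R, I t ->
    exists2 c : R, 0 < c & e1 t = c *: derive1 x t ;
  frame_dx : forall t : R, I t -> derive1 x t = w t *: e1 t ;
  frame_de1 : forall t : R, I t -> derive1 e1 t = w t *: e2 t ;
  frame_de2 : forall t : R, I t -> derive1 e2 t = w t *: e3 t ;
  frame_de3 : forall t : R, I t ->
    derive1 e3 t = - (m t * w t) *: e1 t - (l t * w t) *: e2 t
}.

Definition affine_inflection (R : realType) (l : R -> R) (t : R) : Prop :=
  l t = 0.

(* At a point that is not an affine inflection point this is +1 or -1. *)
Definition affine_sign (R : realType) (l : R -> R) (t : R) : R := Num.sg (l t).

(* The coefficient of dt in omega_s = sqrt (eps l) omega. *)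
Definition ga_length_element (R : realType) (w l : R -> R) (t : R) : R :=
  Num.sqrt (affine_sign l t * l t) * w t.

(* dl / l = k omega_s *)
Definition first_ga_curvature (R : realType) (I : set R) (w l k : R -> R) :
    Prop :=
  forall t : R, I t ->
    derive1 l t / l t = k t * ga_length_element w l t.

Definition second_ga_curvature (R : realType) (l m : R -> R) (t : R) : R :=
  m t / (affine_sign l t * l t) `^ (3 / 2).

(* s = sigma t satisfies ds = omega_s on I, and t = tau s is the inverse change
   of parameter, from sigma @` I back to I. *)
Definition ga_length_parameter (R : realType) (I : set R) (w l : R -> R)
    (sigma tau : R -> R) : Prop :=
  forall t : R, I t ->
    is_derive t 1 sigma (ga_length_element w l t) /\
    tau (sigma t) = t.

(* Main.v *)
Require Import Defs.
From HB Require Import structures.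
From mathcomp Require Import all_boot all_order all_algebra.
From mathcomp Require Import all_classical all_reals all_analysis.
From mathcomp Require Import ring.

(** Write [P = 1 / sqrt (eps l)], so that [omega = P ds].  Along the length
parameter [s], and with ['] for the derivative in [s], the structure equations
become
  [x' = P e1], [e1' = P e2], [e2' = P e3], [e3' = - m P e1 - l P e2],
and [dl / l = k ds] gives [P' = - (k / 2) P].  Differentiating [x' = P e1] three
times therefore expresses the first four derivatives of [x] in the frame, with
coefficients that are polynomials in [P], [k], [k'], [k''], [l] and [m].  Since
[l P^2 = eps] and [m P^3 = M], only the curvatures and [eps] remain once [P],
[P^2], [P^3] are factored out of the coefficients of [e1], [e2], [e3].  The
equation is then one polynomial identity for each frame vector
([structure_equations_ode]): the coefficient [3 k] removes [e3], and the
coefficients of [x''] and [x'] are the ones that remove [e2] and [e1].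

Two analytic facts are needed to justify this calculation.  First, [s] must be
an admissible parameter: [w > 0] because [e1] is a positive multiple of the
velocity, so [ds/dt] never vanishes, the set of parameters [s] is open, and
[dt/ds] is the inverse of [ds/dt] ([open_parameter_range],
[is_derive_inverse_parameter]).  Second, [k] must be twice differentiable in
[s].  The curvature [k] is only given by its defining equation, which exhibits
it as a quotient built from [l], its derivative, [w] and a square root; such
expressions are smooth ([smooth_expr_on]). *)

Set Implicit Arguments.
Unset Strict Implicit.
Unset Printing Implicit Defensive.

Import Order.TTheory GRing.Theory Num.Theory.
Import numFieldNormedType.Exports.

Local Open Scope ring_scope.
Local Open Scope classical_set_scope.

(** * Derivatives of curves *)

Section Calculus.
Variables (R : realType) (V : normedModType R).
Implicit Types (f g : R -> R) (u : R -> V) (I : set R) (t s : R).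

(** The difference quotient is split as
[f (t + h) (u (t + h) - u t) / h + (f (t + h) - f t) / h u t]. *)
Lemma is_derive_scalef f u t (a : R) (v : V) :
  is_derive t 1 f a -> is_derive t 1 u v ->
  is_derive t 1 (fun r => f r *: u r) (f t *: v + a *: u t).
Proof.
move=> [df <-] [du <-].
have lim_quot : (fun h => h^-1 *: (((fun r => f r *: u r) \o shift t) (h *: 1)
    - f t *: u t)) @ 0^' --> f t *: 'D_1 u t + 'D_1 f t *: u t.
  rewrite [X in X @ _](_ : _ =
    fun h => f (h *: 1 + t) *: (h^-1 *: ((u \o shift t) (h *: 1) - u t))
             + (h^-1 *: ((f \o shift t) (h *: 1) - f t)) *: u t); last first.
    apply/funext => h /=.
    rewrite -[(h^-1 *: (_ - f t)) *: _]scalerA [f _ *: (h^-1 *: _)]scalerA.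
    rewrite [f _ * h^-1]mulrC -scalerA -scalerDr scalerBl.
    by congr (_ *: _); rewrite scalerBr addrA subrK.
  apply: cvgD; last exact: cvgZr_tmp df.
  apply: cvgZ; last exact: du.
  suff {1}<- : f (0 *: 1 + t) = f t.
    suff : {for 0, continuous (fun h : R => f (h *: 1 + t))}.
      by move=> /continuous_withinNx.
    exact/differentiable_continuous/derivable1_diffP/(derivable1P _ _ _).1.
  by rewrite scale0r add0r.
apply: DeriveDef; last exact: cvg_lim lim_quot.
by apply/cvg_ex; eexists; exact: lim_quot.
Qed.

Lemma is_derive_reparam u g s (v : V) (a : R) :
  is_derive (g s) 1 u v -> is_derive s 1 g a ->
  is_derive s 1 (fun r => u (g r)) (a *: v).
Proof.
move=> [du <-] [dg <-].
have du' : differentiable u (g s) by exact/derivable1_diffP.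
have dg' : differentiable g s by exact/derivable1_diffP.
have dug : differentiable (u \o g) s by exact: differentiable_comp.
apply: DeriveDef; first exact/derivable1_diffP.
rewrite deriveE// (diff_comp dg' du') /= (diff1E du') (diff1E dg').
by rewrite !derive1E scale1r.
Qed.

(** A derivative only depends on the germ of the function. *)
Lemma is_derive_agree I (u u' : R -> V) t (v : V) : open I -> I t ->
  (forall r, I r -> u r = u' r) -> is_derive t 1 u v -> is_derive t 1 u' v.
Proof.
move=> oI It uu'; apply: near_eq_is_derive.
have It' : \forall r \near t, I r by exact: open_nbhs_nbhs.
by near=> r; apply: uu'; near: r.
Unshelve. all: by end_near. Qed.

(** Iterated derivatives are taken of functions on the whole line, whereas the
candidates [c n] for them are known to be derivatives only on [I].  Openness of
[I] is what lets one identify the [n]-th derivative with [c n] near each point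
and differentiate once more. *)
Lemma derive1n_chain I (c : nat -> R -> V) N : open I ->
  (forall n t, (n < N)%N -> I t -> is_derive t 1 (c n) (c n.+1 t)) ->
  forall n, (n <= N)%N -> forall t, I t ->
    derive1n n (c 0%N) t = c n t /\
    ((n < N)%N -> derivable (derive1n n (c 0%N)) t 1).
Proof.
move=> oI dc; elim=> [|n ihn] nN t It.
  by split=> // N0; have [] := dc 0%N t N0 It.
suff dE r : I r -> derive1n n.+1 (c 0%N) r = c n.+1 r.
  split=> [|nN']; first exact: dE.
  have dn : is_derive t 1 (derive1n n.+1 (c 0%N)) (c n.+2 t).
    by apply: is_derive_agree oI _ _ (dc n.+1 t nN' It) => // r /dE.
  by case: dn.
move=> Ir.
have dn : is_derive r 1 (derive1n n (c 0%N)) (c n.+1 r).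
  apply: is_derive_agree oI _ _ (dc n r nN Ir) => // q Iq.
  by have [->] := ihn (ltnW nN) q Iq.
by rewrite derive1nS derive1E; case: dn.
Qed.

Lemma smooth_on_is_derive I u t : smooth_on I u -> I t ->
  is_derive t 1 u (derive1 u t).
Proof. by move=> su It; rewrite derive1E; apply/derivableP/(su 0%N). Qed.

Lemma smooth_on_derive1 I u : smooth_on I u -> smooth_on I (derive1 u).
Proof. by move=> su n t It; rewrite -derive1Sn; exact: su. Qed.

(** Smoothness by coinduction: a class of functions that is stable under
differentiation, up to equality on the open set [I], consists of functions
smooth on [I].  This avoids computing higher derivatives of products and
quotients. *)
Lemma smooth_on_coind I (F : (R -> V) -> Prop) : open I ->
  (forall u, F u ->
     exists2 u', F u' & forall t, I t -> is_derive t 1 u (u' t)) ->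
  forall u, F u -> smooth_on I u.
Proof.
move=> oI step u Fu.
have derE n : exists2 v, F v & forall t, I t -> derive1n n u t = v t.
  elim: n => [|n [v Fv uv]]; first by exists u.
  have [v' Fv' dv] := step v Fv; exists v' => // t It.
  have dn : is_derive t 1 (derive1n n u) (v' t).
    by apply: is_derive_agree oI _ _ (dv t It) => // r /uv.
  by rewrite derive1nS derive1E; case: dn.
move=> n t It; have [v Fv uv] := derE n; have [v' _ dv] := step v Fv.
have [] // : is_derive t 1 (derive1n n u) (v' t).
by apply: is_derive_agree oI _ _ (dv t It) => // r /uv.
Qed.

End Calculus.

(** * Expressions in smooth functions *)

(** A class that contains the smooth functions and is visibly stable under
differentiation: the quotient and square root rules stay inside it, since they
only produce sums, products, inverses and the same square roots. *)
Inductive smooth_expr (R : realType) (I : set R) : (R -> R) -> Prop :=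
| SmoothAtom f of smooth_on I f : smooth_expr I f
| SmoothCst c : smooth_expr I (fun=> c)
| SmoothAdd f g of smooth_expr I f & smooth_expr I g :
    smooth_expr I (fun t => f t + g t)
| SmoothMul f g of smooth_expr I f & smooth_expr I g :
    smooth_expr I (fun t => f t * g t)
| SmoothInv f of smooth_expr I f & (forall t, I t -> f t != 0) :
    smooth_expr I (fun t => (f t)^-1)
| SmoothSqrt f of smooth_expr I f & (forall t, I t -> 0 < f t) :
    smooth_expr I (fun t => Num.sqrt (f t)).

Lemma smooth_expr_on (R : realType) (I : set R) f :
  open I -> smooth_expr I f -> smooth_on I f.
Proof.
move=> oI; move: f; apply: smooth_on_coind => // f.
elim=> {f} [f sf|c|f g _ [f' ef df] _ [g' eg dg]
  |f g Ef [f' ef df] Eg [g' eg dg]|f Ef [f' ef df] f0|f Ef [f' ef df] f0].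
- exists (derive1 f); first exact/SmoothAtom/smooth_on_derive1.
  by move=> t; exact: smooth_on_is_derive.
- exists (fun=> 0); first exact: SmoothCst.
  by move=> t _; exact: is_derive_cst.
- exists (fun t => f' t + g' t); first exact: SmoothAdd.
  by move=> t It; apply: is_deriveD; [exact: df|exact: dg].
- exists (fun t => f t * g' t + g t * f' t).
    by apply: SmoothAdd; apply: SmoothMul.
  by move=> t It; apply: is_deriveM; [exact: df|exact: dg].
- exists (fun t => -1 * ((f t)^-1 * (f t)^-1) * f' t).
    apply: SmoothMul => //; apply: SmoothMul; first exact: SmoothCst.
    by apply: SmoothMul; apply: SmoothInv.
  move=> t It; apply: is_derive_eq (is_deriveV (f0 t It) (df t It)) _.
  by rewrite mulN1r -invfM -expr2.
- exists (fun t => (2 * Num.sqrt (f t))^-1 * f' t).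
    apply: SmoothMul => //; apply: SmoothInv => [|t It].
      by apply: SmoothMul; [exact: SmoothCst|exact: SmoothSqrt].
    by rewrite mulf_neq0 ?pnatr_eq0// gt_eqF// sqrtr_gt0 f0.
  move=> t It; apply: is_derive1_comp; last exact: df.
  exact/is_derive1_sqrt/f0.
Qed.

(** * Inverting a change of parameter *)

Section InverseParameter.
Variables (R : realType) (I : set R) (sigma tau rho : R -> R).
Hypothesis I_open : open I.
Hypothesis d_sigma : forall t, I t -> is_derive t 1 sigma (rho t).
Hypothesis sigmaK : forall t, I t -> tau (sigma t) = t.

Let nearI t : I t -> \forall r \near t, I r.
Proof. by move=> It; exact: open_nbhs_nbhs. Qed.

Let near_sigmaK t : I t -> {near t, cancel sigma tau}.
Proof. by move=> It; near=> r; apply: sigmaK; near: r; exact: nearI.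
Unshelve. all: by end_near. Qed.

Let near_sigma_cont t : I t -> {near t, continuous sigma}.
Proof.
move=> It; near=> r; have Ir : I r by near: r; exact: nearI.
by apply/differentiable_continuous/derivable1_diffP; case: (d_sigma Ir).
Unshelve. all: by end_near. Qed.

(** Near [sigma t] the left inverse [tau] is continuous and is also a right
inverse, so [tau s] lies in the open set [I] for [s] near [sigma t]. *)
Lemma open_parameter_range : open (sigma @` I).
Proof.
rewrite openE => _ [t It <-]; rewrite /interior /=.
have [tau_cont tauK] :=
  near_can_continuousAcan_sym (near_sigmaK It) (near_sigma_cont It).
have tau_t : {for sigma t, continuous tau} by exact: nbhs_singleton tau_cont.
have Itau : \forall s \near sigma t, I (tau s).
  by apply: tau_t; rewrite sigmaK//; exact: nearI.
near=> s; exists (tau s); first by near: s.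
by near: s.
Unshelve. all: by end_near. Qed.

Lemma is_derive_inverse_parameter s : (forall t, I t -> rho t != 0) ->
  (sigma @` I) s -> is_derive s 1 tau (rho (tau s))^-1.
Proof.
move=> rho0 [t It <-]; rewrite sigmaK//.
by apply: is_derive_inverse (rho0 t It);
  [exact: near_sigmaK|exact: near_sigma_cont|exact: d_sigma].
Qed.

End InverseParameter.

(** * From the structure equations to the differential equation *)

Section StructureEquations.
Variables (R : realType) (V : normedModType R) (J : set R).
Variables (y E1 E2 E3 : R -> V) (P K K1 K2 l m M : R -> R) (eps : R).
Hypothesis J_open : open J.
Hypothesis dy : forall s, J s -> is_derive s 1 y (P s *: E1 s).
Hypothesis dE1 : forall s, J s -> is_derive s 1 E1 (P s *: E2 s).
Hypothesis dE2 : forall s, J s -> is_derive s 1 E2 (P s *: E3 s).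
Hypothesis dE3 : forall s, J s ->
  is_derive s 1 E3 (P s *: (- m s *: E1 s - l s *: E2 s)).
Hypothesis dP : forall s, J s -> is_derive s 1 P (- (K s / 2) * P s).
Hypothesis dK : forall s, J s -> is_derive s 1 K (K1 s).
Hypothesis dK1 : forall s, J s -> is_derive s 1 K1 (K2 s).
Hypothesis lP2 : forall s, J s -> l s * P s ^+ 2 = eps.
Hypothesis mP3 : forall s, J s -> m s * P s ^+ 3 = M s.

Let comb (a b c : R -> R) s := a s *: E1 s + b s *: E2 s + c s *: E3 s.

Lemma is_derive_frame_combination (a b c : R -> R) s a' b' c' : J s ->
  is_derive s 1 a a' -> is_derive s 1 b b' -> is_derive s 1 c c' ->
  is_derive s 1 (fun r => a r *: E1 r + b r *: E2 r + c r *: E3 r)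
    ((a' - c s * m s * P s) *: E1 s + (a s * P s + b' - c s * l s * P s) *: E2 s
     + (b s * P s + c') *: E3 s).
Proof.
move=> Js da db dc.
have dab := is_deriveD (is_derive_scalef da (dE1 Js))
  (is_derive_scalef db (dE2 Js)).
apply: is_derive_eq (is_deriveD dab (is_derive_scalef dc (dE3 Js))) _.
rewrite !scalerBr !scalerA !scalerDl !scaleNr mulrN scaleNr.
(* Gather the seven terms by frame vector. *)
rewrite [LHS](AC ((2*2)*(2*1)) ((2*5)*((1*4)*6)*(3*7))).
by rewrite (mulrAC (c s) (m s)) (mulrAC (c s) (l s)).
Qed.

(* The successive derivatives of [y] in the frame.  In [y4] the products
   [m P^3] and [l P^2] are already replaced by [M] and [eps]. *)
Let y1 := comb P (fun=> 0) (fun=> 0).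
Let y2 := comb (fun s => - 2^-1 * K s * P s) (fun s => P s ^+ 2) (fun=> 0).
Let y3 := comb (fun s => (4^-1 * K s ^+ 2 + - 2^-1 * K1 s) * P s)
  (fun s => - (3 / 2) * K s * P s ^+ 2) (fun s => P s ^+ 3).
Let y4 := comb
  (fun s => (- (K2 s / 2) + 3 / 4 * K s * K1 s - K s ^+ 3 / 8 - M s) * P s)
  (fun s => (7 / 4 * K s ^+ 2 - 2 * K1 s - eps) * P s ^+ 2)
  (fun s => - (3 * K s * P s ^+ 3)).

(* The coefficients [da], [db], [dc] come as the product rule yields them; the
   equations reduce the check of a derivative to identities between numbers. *)
Let is_derive_comb (a b c a' b' c' : R -> R) s (da db dc : R) : J s ->
  is_derive s 1 a da -> is_derive s 1 b db -> is_derive s 1 c dc ->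
  da = a' s + c s * m s * P s ->
  db = b' s - a s * P s + c s * l s * P s ->
  dc = c' s - b s * P s ->
  is_derive s 1 (comb a b c) (comb a' b' c' s).
Proof.
move=> Js da_ db_ dc_ daE dbE dcE.
apply: is_derive_eq (is_derive_frame_combination Js da_ db_ dc_) _.
by rewrite daE dbE dcE /comb; congr (_ *: _ + _ *: _ + _ *: _); ring.
Qed.

(* The calculus rules in pointwise form, so that the values of the coefficients
   are polynomial expressions in numbers, as ring and field require. *)
Let d0 (s : R) : is_derive s 1 (fun=> 0 : R) (0 : R).
Proof. exact: is_derive_cst. Qed.

Let dD (f g : R -> R) (s f' g' : R) :
  is_derive s 1 f f' -> is_derive s 1 g g' ->
  is_derive s 1 (fun r => f r + g r) (f' + g').
Proof. exact: is_deriveD. Qed.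

Let dM (f g : R -> R) (s f' g' : R) :
  is_derive s 1 f f' -> is_derive s 1 g g' ->
  is_derive s 1 (fun r => f r * g r) (f s * g' + g s * f').
Proof. exact: is_deriveM. Qed.

Let dcM c (f : R -> R) (s f' : R) :
  is_derive s 1 f f' -> is_derive s 1 (fun r => c * f r) (c * f').
Proof. exact: is_deriveZ. Qed.

Let dX n (f : R -> R) (s f' : R) :
  is_derive s 1 f f' ->
  is_derive s 1 (fun r => f r ^+ n) (n%:R * f s ^+ n.-1 * f').
Proof. by move=> df; rewrite -exprfctE; exact: is_deriveX. Qed.

Let dP2 s : J s -> is_derive s 1 (fun r => P r ^+ 2) (- K s * P s ^+ 2).
Proof. by move=> Js; apply: is_derive_eq (dX 2 (dP Js)) _; field. Qed.

Let dP3 s : J s ->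
  is_derive s 1 (fun r => P r ^+ 3) (- (3 / 2) * K s * P s ^+ 3).
Proof. by move=> Js; apply: is_derive_eq (dX 3 (dP Js)) _; field. Qed.

Let d_y1 s : J s -> is_derive s 1 y1 (y2 s).
Proof.
by move=> Js; apply: (is_derive_comb Js (dP Js) (d0 s) (d0 s)); field.
Qed.

Let d_y2 s : J s -> is_derive s 1 y2 (y3 s).
Proof.
move=> Js; have da := dM (dcM (- 2^-1) (dK Js)) (dP Js).
by apply: (is_derive_comb Js da (dP2 Js) (d0 s)); field.
Qed.

Let d_y3 s : J s -> is_derive s 1 y3 (y4 s).
Proof.
move=> Js.
have da := dM (dD (dcM 4^-1 (dX 2 (dK Js))) (dcM (- 2^-1) (dK1 Js))) (dP Js).
have db := dM (dcM (- (3 / 2)) (dK Js)) (dP2 Js).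
apply: (is_derive_comb Js da db (dP3 Js)).
- by rewrite -mP3//; field.
- by rewrite -(lP2 Js); field.
- by field.
Qed.

(** Here [P] is [omega / ds], and [K1], [K2] are the derivatives of the first
curvature [K].  Each of the three frame coefficients of the left-hand side
vanishes, so the equation holds in any normed space, whatever the frame. *)
Lemma structure_equations_ode s : J s ->
  (forall n, (n < 4)%N -> derivable (derive1n n y) s 1) /\
  derive1n 4 y s
  + (3 * K s) *: derive1n 3 y s
  + (2 * K1 s + 11 / 4 * K s ^+ 2 + eps) *: derive1n 2 y s
  + (M s + 1 / 2 * eps * K s + 1 / 2 * K2 s
     + 7 / 4 * K s * K1 s + 3 / 4 * K s ^+ 3) *: derive1 y s = 0.
Proof.
move=> Js.
have chain n t : (n < 4)%N -> J t -> is_derive t 1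
    (nth (fun=> 0) [:: y; y1; y2; y3; y4] n)
    (nth (fun=> 0) [:: y; y1; y2; y3; y4] n.+1 t).
  case: n => [|[|[|[|//]]]] _ Jt /=; last 3 first.
  - exact: d_y1.
  - exact: d_y2.
  - exact: d_y3.
  by rewrite /y1 /comb !scale0r !addr0; exact: dy.
have yE n (n4 : (n <= 4)%N) := (derive1n_chain J_open chain n4 Js).
split=> [n n4|]; first exact: (yE n (ltnW n4)).2.
rewrite -derive1n1 (yE 1%N isT).1 (yE 2%N isT).1 (yE 3%N isT).1 (yE 4%N isT).1.
rewrite /= /y1 /y2 /y3 /y4 /comb !scalerDr !scalerA.
(* Gather the terms in [E1], [E2], [E3] of the four combinations. *)
rewrite [LHS](AC (3*3*3*3) ((1*4*7*10)*(2*5*8*11)*(3*6*9*12))).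
rewrite /= -!scalerDl.
rewrite [X in X *: E1 s](_ : _ = 0); last by field.
rewrite [X in X *: E2 s](_ : _ = 0); last by field.
rewrite [X in X *: E3 s](_ : _ = 0); last by field.
by rewrite !scale0r !addr0.
Qed.

End StructureEquations.

(** * The structure equations in the length parameter *)

Lemma powR_three_halves (R : realType) (a : R) :
  0 <= a -> a `^ (3 / 2) = Num.sqrt a ^+ 3.
Proof.
by move=> a0; rewrite mulrC powRrM powR12_sqrt// powR_mulrn// sqrtr_ge0.
Qed.

Section CurveInLengthParameter.
Variables (R : realType) (I : set R) (x e1 e2 e3 : R -> 'rV[R]_3).
Variables (w l m : R -> R) (eps : R).
Hypothesis I_open : open I.
Hypothesis x_nondeg : nondegenerate_curve I x.
Hypothesis frame : affine_frame I x e1 e2 e3 w l m.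
Hypothesis no_inflection : forall t : R, I t -> ~ affine_inflection l t.
Hypothesis sign_eps : forall t : R, I t -> affine_sign l t = eps.

(** The two relations between [e1] and the velocity, [x' = w e1] and
[e1 = c x'], give [w c = 1], as [x'] does not vanish. *)
Lemma frame_coef_gt0 t : I t -> 0 < w t.
Proof.
move=> It; have [c c0 e1E] := frame_positive frame It.
have dx0 : derive1 x t != 0.
  have := x_nondeg It; rewrite free_cons => /andP[+ _].
  by apply: contraNneq => ->; exact: mem0v.
have := frame_dx frame It; rewrite e1E scalerA => /eqP.
rewrite -{1}[derive1 x t]scale1r -subr_eq0 -scalerBl scaler_eq0 (negbTE dx0).
by rewrite orbF subr_eq0 => /eqP wc; rewrite -(pmulr_lgt0 _ c0) -wc.
Qed.

Lemma sign_mul_gt0 t : I t -> 0 < eps * l t.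
Proof.
move=> It; rewrite -(sign_eps It) /affine_sign -normrEsg normr_gt0.
by apply/eqP; exact: no_inflection.
Qed.

Lemma sign_sqr t : I t -> eps ^+ 2 = 1.
Proof.
move=> It; rewrite -(sign_eps It) /affine_sign sqr_sg.
by case: eqP => // /(no_inflection It).
Qed.

Lemma length_elementE t : I t ->
  ga_length_element w l t = Num.sqrt (eps * l t) * w t.
Proof. by move=> It; rewrite /ga_length_element sign_eps. Qed.

Lemma length_element_neq0 t : I t -> ga_length_element w l t != 0.
Proof.
move=> It; rewrite length_elementE// gt_eqF// mulr_gt0//.
  by rewrite sqrtr_gt0 sign_mul_gt0.
exact: frame_coef_gt0.
Qed.

(* The length element on [I], with the sign of [l] replaced by the constant
   [eps] so that it becomes a smooth expression. *)
Let rho t := Num.sqrt (eps * l t) * w t.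

Let smooth_rho : smooth_expr I rho.
Proof.
apply: SmoothMul; last exact/SmoothAtom/(frame_smoothw frame).
apply: SmoothSqrt; last exact: sign_mul_gt0.
by apply: SmoothMul; [exact: SmoothCst|exact/SmoothAtom/(frame_smoothl frame)].
Qed.

Let rho_neq0 t : I t -> rho t != 0.
Proof. by move=> It; rewrite /rho -length_elementE// length_element_neq0. Qed.

Let smooth_expr_derive1 f : smooth_expr I f -> smooth_expr I (derive1 f).
Proof.
by move=> sf; apply/SmoothAtom/smooth_on_derive1/smooth_expr_on.
Qed.

Let smooth_div_rho f :
  smooth_expr I f -> smooth_expr I (fun t => f t * (rho t)^-1).
Proof. by move=> sf; apply: SmoothMul => //; apply: SmoothInv. Qed.

(* The curvature [k] agrees on [I] with [kappa], whose smoothness can be read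
   off its form. *)
Let kappa t := derive1 l t * (l t)^-1 * (rho t)^-1.

Let smooth_kappa : smooth_expr I kappa.
Proof.
have sl : smooth_expr I l by exact/SmoothAtom/(frame_smoothl frame).
apply: smooth_div_rho; apply: SmoothMul; first exact: smooth_expr_derive1.
by apply: SmoothInv => // t It; apply/eqP; exact: no_inflection.
Qed.

Variables (k sigma tau : R -> R).
Hypothesis x_smooth : smooth_on I x.
Hypothesis first_k : first_ga_curvature I w l k.
Hypothesis length_s : ga_length_parameter I w l sigma tau.

Let kappaE t : I t -> kappa t = k t.
Proof.
move=> It; rewrite /kappa (first_k It) length_elementE// -/(rho t).
by rewrite mulfK// rho_neq0.
Qed.

Let J := sigma @` I.

Let J_open : open J.
Proof.
by apply: (open_parameter_range I_open) => t It;
  [exact: (length_s It).1|exact: (length_s It).2].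
Qed.

Let tau_I s : J s -> I (tau s).
Proof. by move=> [t It <-]; have [_ ->] := length_s It. Qed.

Lemma is_derive_length_parameter (V : normedModType R) (u : R -> V) s v : J s ->
  is_derive (tau s) 1 u v ->
  is_derive s 1 (fun r => u (tau r)) ((rho (tau s))^-1 *: v).
Proof.
move=> Js du; apply: is_derive_reparam du _.
apply: (is_derive_inverse_parameter I_open) Js => t It.
- by rewrite /rho -length_elementE//; exact: (length_s It).1.
- exact: (length_s It).2.
- exact: rho_neq0.
Qed.

Let P s := (Num.sqrt (eps * l (tau s)))^-1.

Let P_rho s : J s -> (rho (tau s))^-1 * w (tau s) = P s.
Proof.
move=> Js; rewrite /rho invfM -mulrA mulVf ?mulr1//.
by rewrite gt_eqF// frame_coef_gt0//; exact: tau_I.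
Qed.

(* As [P = L^-1] with [L^2 = eps l], twice the logarithmic derivative of [P] is
   minus that of [l], which is [k]. *)
Let dP s : J s -> is_derive s 1 P (- (k (tau s) / 2) * P s).
Proof.
move=> Js; have It := tau_I Js; have l0 := sign_mul_gt0 It.
have L0 : Num.sqrt (eps * l (tau s)) != 0 by rewrite gt_eqF// sqrtr_gt0.
have w0 : w (tau s) != 0 by rewrite gt_eqF// frame_coef_gt0.
have dl := smooth_on_is_derive (frame_smoothl frame) It.
have del : is_derive (tau s) 1 (fun t => eps * l t) (eps * derive1 l (tau s)).
  exact: is_deriveZ.
pose L t := Num.sqrt (eps * l t).
have dL : is_derive (tau s) 1 L _ :=
  @is_derive1_comp _ Num.sqrt (fun t => eps * l t) _ _ _
    (is_derive1_sqrt l0) del.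
have dV := @is_deriveV _ L _ _ _ L0 dL.
have dPs : is_derive s 1 P _ := is_derive_length_parameter Js dV.
apply: is_derive_eq dPs _.
have L2 := sqr_sqrtr (ltW l0).
have lE : l (tau s) = eps * Num.sqrt (eps * l (tau s)) ^+ 2.
  by rewrite L2 mulrA -expr2 (sign_sqr It) mul1r.
have eps0 : eps != 0 by apply: contraTneq l0 => ->; rewrite mul0r ltxx.
have epsV : eps^-1 = eps.
  by rewrite -[LHS]mul1r -(sign_sqr It) expr2 mulfK.
rewrite -kappaE// /kappa {2}lE /P /rho /L /= /GRing.scale/=.
rewrite [(eps * _)^-1]invfM epsV.
move: L0; set A := Num.sqrt _ => L0.
by field; rewrite L0 w0.
Qed.

Lemma second_ga_curvatureE s : J s ->
  m (tau s) * P s ^+ 3 = second_ga_curvature l m (tau s).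
Proof.
move=> Js; have It := tau_I Js.
rewrite /second_ga_curvature sign_eps// powR_three_halves ?exprVn//.
exact/ltW/sign_mul_gt0.
Qed.

Let lP2 s : J s -> l (tau s) * P s ^+ 2 = eps.
Proof.
move=> Js; have It := tau_I Js; have l0 := sign_mul_gt0 It.
rewrite exprVn sqr_sqrtr ?ltW//; apply: (canLR (mulfK _)).
  by rewrite gt_eqF.
by rewrite mulrA -expr2 (sign_sqr It) mul1r.
Qed.

Let K s := k (tau s).
Let K1 s := (rho (tau s))^-1 *: derive1 kappa (tau s).
Let kappa1 t := derive1 kappa t * (rho t)^-1.
Let K2 s := (rho (tau s))^-1 *: derive1 kappa1 (tau s).

Let dK s : J s -> is_derive s 1 K (K1 s).
Proof.
move=> Js; have It := tau_I Js.
have dkappa := smooth_on_is_derive (smooth_expr_on I_open smooth_kappa) It.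
apply: is_derive_agree J_open Js _ (is_derive_length_parameter Js dkappa).
by move=> r Jr; rewrite kappaE//; exact: tau_I.
Qed.

Let dK1 s : J s -> is_derive s 1 K1 (K2 s).
Proof.
move=> Js; have It := tau_I Js.
have sk1 : smooth_expr I kappa1.
  exact/smooth_div_rho/smooth_expr_derive1/smooth_kappa.
have dk1 := smooth_on_is_derive (smooth_expr_on I_open sk1) It.
apply: is_derive_agree J_open Js _ (is_derive_length_parameter Js dk1).
by move=> r Jr; rewrite /kappa1 mulrC.
Qed.

Lemma curvature_derivatives s : J s ->
  [/\ forall n, (n < 2)%N -> derivable (derive1n n K) s 1,
      derive1 K s = K1 s & derive1n 2 K s = K2 s].
Proof.
move=> Js.
have chain n t : (n < 2)%N -> J t -> is_derive t 1
    (nth (fun=> 0) [:: K; K1; K2] n) (nth (fun=> 0) [:: K; K1; K2] n.+1 t).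
  by case: n => [|[|//]] _ Jt /=; [exact: dK|exact: dK1].
have KE n (n2 : (n <= 2)%N) := (derive1n_chain J_open chain n2 Js).
split=> [n n2||]; first exact: (KE n (ltnW n2)).2.
  exact: (KE 1%N isT).1.
exact: (KE 2%N isT).1.
Qed.

(** Changing the parameter divides the structure equations by [rho], which turns
their common factor [w] into [P]. *)
Lemma curve_ode s (y := fun s => x (tau s))
    (M := second_ga_curvature l m (tau s)) :
  J s ->
  (forall n, (n < 4)%N -> derivable (derive1n n y) s 1) /\
  derive1n 4 y s
  + (3 * K s) *: derive1n 3 y s
  + (2 * K1 s + 11 / 4 * K s ^+ 2 + eps) *: derive1n 2 y s
  + (M + 1 / 2 * eps * K s + 1 / 2 * K2 s
     + 7 / 4 * K s * K1 s + 3 / 4 * K s ^+ 3) *: derive1 y s = 0.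
Proof.
move=> Js.
have d_along (u e : R -> 'rV[R]_3) : smooth_on I u ->
    (forall t, I t -> derive1 u t = w t *: e t) ->
    forall r, J r -> is_derive r 1 (fun q => u (tau q)) (P r *: e (tau r)).
  move=> su uE r Jr; have Ir := tau_I Jr.
  apply: is_derive_eq
    (is_derive_length_parameter Jr (smooth_on_is_derive su Ir)) _.
  by rewrite uE// scalerA P_rho.
apply: (structure_equations_ode J_open
  (d_along _ _ x_smooth (frame_dx frame))
  (d_along _ _ (frame_smooth1 frame) (frame_de1 frame))
  (d_along _ _ (frame_smooth2 frame) (frame_de2 frame))
  (d_along _ (fun t => - m t *: e1 t - l t *: e2 t)
     (frame_smooth3 frame) _) dP dK dK1 lP2 second_ga_curvatureE Js).
move=> t It; rewrite (frame_de3 frame It) scalerBr !scalerA.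
by rewrite mulrN ![w t * _]mulrC.
Qed.

End CurveInLengthParameter.

Theorem lemma5p3 (R : realType) (I : set R)
    (x e1 e2 e3 : R -> 'rV[R]_3) (w l m k sigma tau : R -> R) (eps : R)
    (I_open : open I) (I_itv : is_interval I)
    (x_smooth : smooth_on I x) (x_nondeg : nondegenerate_curve I x)
    (frame : affine_frame I x e1 e2 e3 w l m)
    (no_inflection : forall t : R, I t -> ~ affine_inflection l t)
    (sign_eps : forall t : R, I t -> affine_sign l t = eps)
    (first_k : first_ga_curvature I w l k)
    (length_s : ga_length_parameter I w l sigma tau) :
  let y : R -> 'rV[R]_3 := fun s => x (tau s) in
  let K : R -> R := fun s => k (tau s) in
  let M : R -> R := fun s => second_ga_curvature l m (tau s) in
  forall s : R, (sigma @` I) s ->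
    [/\ forall n : nat, (n < 4)%N -> derivable (derive1n n y) s 1,
        forall n : nat, (n < 2)%N -> derivable (derive1n n K) s 1 &
        derive1n 4 y s
        + (3 * K s) *: derive1n 3 y s
        + (2 * derive1 K s + 11 / 4 * K s ^+ 2 + eps) *: derive1n 2 y s
        + (M s + 1 / 2 * eps * K s + 1 / 2 * derive1n 2 K s
           + 7 / 4 * K s * derive1 K s + 3 / 4 * K s ^+ 3) *: derive1 y s = 0].
Proof.
move=> y K M s Js.
have [dK K1E K2E] := curvature_derivatives I_open x_nondeg frame no_inflection
  sign_eps first_k length_s Js.
have [dy ode] := curve_ode I_open x_nondeg frame no_inflection sign_eps x_smooth
  first_k length_s Js.
by split=> //; rewrite K1E K2E.
Qed.
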